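(* Let $k,n,p\ge 1$ and let $\mathcal{A}\in\mathbb{C}^{n\times\dots\times n\times p}$ be an order $2k+1$ $t$-conjugate partially symmetric hypermatrix. Then $\mathcal{A}$ is $t$-Hermitian positive definite (respectively, semidefinite) if and only if $\widehat{\mathcal{A}}_{(\ell)}$ is Hermitian positive definite (respectively, semidefinite) for each $\ell\in[p]$, which is true if and only if every $\widehat{H}$-eigenvalue of $\widehat{\mathcal{A}}_{(\ell)}$ is positive (respectively, nonnegative), for each $\ell\in[p]$.
   Context: Notation: $[m]=\{1,\dots,m\}$; a hypermatrix of order $N$ is an element of $\mathbb{C}^{n_1\times\dots\times n_N}$. For a tube $a\in\mathbb{C}^p$, $\widehat a=\mathrm{fft}(a)$ is the unnormalized discrete Fourier transform $\widehat a[\ell]=\sum_{m=1}^p e^{-2\pi i(\ell-1)(m-1)/p}a[m]$. For a hypermatrix whose last mode (the tubal mode) has length $p$, the hat denotes applying $\mathrm{fft}$ along that mode, and the subscript $(\ell)$ denotes the $\ell$-th frontal slice, i.e. the last index fixed equal to $\ell$. Conjugate partial symmetry: an order $2k$ hypermatrix $\mathcal{B}=[b_{i_1\dots i_kj_1\dots j_k}]\in\mathbb{C}^{n\times\dots\times n}$ is conjugate partially symmetric if $\overline{b_{j_{\sigma(1)}\dots j_{\sigma(k)}i_{\tau(1)}\dots i_{\tau(k)}}}=b_{i_1\dots i_kj_1\dots j_k}$ for all indices and all $\sigma,\tau\in S_k$. An order $2k+1$ hypermatrix $\mathcal{A}\in\mathbb{C}^{n\times\dots\times n\times p}$ is $t$-conjugate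 partially symmetric if every $\widehat{\mathcal{A}}_{(\ell)}$, $\ell\in[p]$, is conjugate partially symmetric. Classical positivity: $h_{\mathcal{B}}(z)=\sum b_{i_1\dots i_kj_1\dots j_k}\overline{z_{i_1}}\cdots\overline{z_{i_k}}z_{j_1}\cdots z_{j_k}$ for $z\in\mathbb{C}^n$; $\mathcal{B}$ is Hermitian positive definite (semidefinite) if $h_{\mathcal{B}}(z)>0$ ($\ge 0$) for all nonzero $z\in\mathbb{C}^n$. $\widehat{H}$-eigenvalues: $\lambda\in\mathbb{C}$ is an $\widehat{H}$-eigenvalue of $\mathcal{B}$ if there is a nonzero $z\in\mathbb{C}^n$ with $\sum_{i_2,\dots,i_k,j_1,\dots,j_k=1}^n b_{ii_2\dots i_kj_1\dots j_k}\overline{z_{i_2}}\cdots\overline{z_{i_k}}z_{j_1}\cdots z_{j_k}=\lambda|z_i|^{2(k-1)}z_i$ for all $i\in[n]$. $t$-Hermitian forms: $\mathbb{T}_p=\mathbb{C}^{1\times1\times p}\cong\mathbb{C}^p$ is the algebra of tubes with product the circular convolution $(a\circledast b)[\ell]=\sum_{m=1}^p a[m]\,b[((\ell-m)\bmod p)+1]$, and $\mathbb{T}_p^n\cong\mathbb{C}^{n\times1\times p}$. Fourier conjugation $J$ acts on tubes by $J(a)[\ell+1]=\overline{a[((-\ell)\bmod p)+1]}$, $\ell=0,\dots,p-1$, and entrywise (tube by tube) on $\mathbb{T}_p^n$. For $\mathcal{Z}\in\mathbb{T}_p^n$ with tubes $\mathcal{Z}[i,:]$, the degree $k$ $t$-Hermitian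 form is $h_{\mathcal{A}}(\mathcal{Z})=\sum \mathcal{A}[i_1,\dots,i_k,j_1,\dots,j_k,:]\circledast J(\mathcal{Z}[i_1,:])\circledast\cdots\circledast J(\mathcal{Z}[i_k,:])\circledast\mathcal{Z}[j_1,:]\circledast\cdots\circledast\mathcal{Z}[j_k,:]\in\mathbb{T}_p$, summing over all indices in $[n]$. $t$-positivity: $\mathbb{T}_p^+=\{a\in\mathbb{T}_p:\widehat a[\ell]\ge0\text{ for all }\ell\in[p]\}$. $\mathcal{A}$ (equivalently $h_{\mathcal{A}}$) is $t$-Hermitian positive definite (semidefinite) if $h_{\mathcal{A}}(\mathcal{Z})\in\mathbb{T}_p^+\setminus\{0\}$ ($\in\mathbb{T}_p^+$) for all nonzero $\mathcal{Z}\in\mathbb{T}_p^n$. *)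

(* Defs.v *)
From HB Require Import structures.
From mathcomp Require Import all_boot all_order all_algebra all_fingroup.
From mathcomp Require Import complex.
From mathcomp Require Import reals trigo.
Set Implicit Arguments.
Unset Strict Implicit.
Unset Printing Implicit Defensive.
Import Order.TTheory GRing.Theory Num.Theory.
Local Open Scope ring_scope.

(* Indices are 0-based: ['I_n] is {0, ..., n-1}.  The order on [R[i]] is the
   partial order of a numClosedFieldType: [0 <= z] (resp. [0 < z]) means that
   [z] is real and nonnegative (resp. positive).  [x ^+ 0 = 1], also for
   [x = 0]. *)

Section Hypermatrices.
Variables (R : realType) (n : nat).

(* The 2k indices (i_1, ..., i_k, j_1, ..., j_k) are split into two k-tuples. *)
Definition hypermatrix (k : nat) :=
  k.-tuple 'I_n -> k.-tuple 'I_n -> R[i].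

Definition perm_tuple (k : nat) (i : k.-tuple 'I_n) (s : 'S_k) :
  k.-tuple 'I_n := [tuple tnth i (s a) | a < k].

Definition conj_partially_symmetric (k : nat) (B : hypermatrix k) : Prop :=
  forall (i j : k.-tuple 'I_n) (s t : 'S_k),
    Num.conj (B (perm_tuple j s) (perm_tuple i t)) = B i j.

Definition hform (k : nat) (B : hypermatrix k) (z : 'cV[R[i]]_n) : R[i] :=
  \sum_(i : k.-tuple 'I_n) \sum_(j : k.-tuple 'I_n)
    B i j * (\prod_(a <- i) Num.conj (z a 0)) * (\prod_(b <- j) z b 0).

Definition hermitian_pd (k : nat) (B : hypermatrix k) : Prop :=
  forall z : 'cV[R[i]]_n, z != 0 -> 0 < hform B z.

Definition hermitian_psd (k : nat) (B : hypermatrix k) : Prop :=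
  forall z : 'cV[R[i]]_n, z != 0 -> 0 <= hform B z.

(* For a hypermatrix of order 2(k+1), so that the exponent 2(k' - 1) attached to
   order 2k' is 2k here; [u] stands for (i_2, ..., i_{k'}). *)
Definition Hhat_eigenvalue (k : nat) (B : hypermatrix k.+1) (lambda : R[i]) :
    Prop :=
  exists2 z : 'cV[R[i]]_n, z != 0 &
    forall i : 'I_n,
      \sum_(u : k.-tuple 'I_n) \sum_(j : k.+1.-tuple 'I_n)
        B (cons_tuple i u) j * (\prod_(a <- u) Num.conj (z a 0))
                        * (\prod_(b <- j) z b 0)
      = lambda * `|z i 0| ^+ (2 * k) * z i 0.

End Hypermatrices.

Section Tubes.
Variables (R : realType) (p : nat).

Definition cexp_neg (theta : R) : R[i] := Complex (cos theta) (- sin theta).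

Definition fft (a : 'rV[R[i]]_p) : 'rV[R[i]]_p :=
  \row_(l < p) \sum_(m < p)
    cexp_neg (2 * pi * l%:R * m%:R / p%:R) * a 0 m.

Definition tube_nonneg (a : 'rV[R[i]]_p) : Prop :=
  forall l : 'I_p, 0 <= fft a 0 l.

End Tubes.

Section Convolution.
Variables (R : realType) (p : nat).

(* Subtraction and opposite in ['I_p.+1] are modulo p+1. *)
Definition tconv (a b : 'rV[R[i]]_p.+1) : 'rV[R[i]]_p.+1 :=
  \row_(l < p.+1) \sum_(m < p.+1) a 0 m * b 0 (l - m).

Definition tconj (a : 'rV[R[i]]_p.+1) : 'rV[R[i]]_p.+1 :=
  \row_(l < p.+1) Num.conj (a 0 (- l)).

End Convolution.

Section TubalHypermatrices.
Variables (R : realType) (n k : nat).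

(* Order 2k+1: the entries are the tubes A[i_1, ..., i_k, j_1, ..., j_k, :]. *)
Definition thypermatrix (p : nat) :=
  k.-tuple 'I_n -> k.-tuple 'I_n -> 'rV[R[i]]_p.

Definition hat_slice (p : nat) (A : thypermatrix p) (l : 'I_p) :
  hypermatrix R n k := fun i j => fft (A i j) 0 l.

Definition t_conj_partially_symmetric (p : nat) (A : thypermatrix p) : Prop :=
  forall l : 'I_p, conj_partially_symmetric (hat_slice A l).

(* An element of T_p^n is an n x p matrix whose rows are its tubes. *)
Definition thform (p : nat) (A : thypermatrix p.+1) (Z : 'M[R[i]]_(n, p.+1)) :
    'rV[R[i]]_p.+1 :=
  \sum_(i : k.-tuple 'I_n) \sum_(j : k.-tuple 'I_n)
    foldl (@tconv R p) (A i j)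
      ([seq tconj (row a Z) | a <- i] ++ [seq row b Z | b <- j]).

Definition t_hermitian_pd (p : nat) (A : thypermatrix p.+1) : Prop :=
  forall Z : 'M[R[i]]_(n, p.+1),
    Z != 0 -> tube_nonneg (thform A Z) /\ thform A Z != 0.

Definition t_hermitian_psd (p : nat) (A : thypermatrix p.+1) : Prop :=
  forall Z : 'M[R[i]]_(n, p.+1), Z != 0 -> tube_nonneg (thform A Z).

End TubalHypermatrices.

(* Main.v *)
(** The discrete Fourier transform turns circular convolution into the pointwise
    product and Fourier conjugation into complex conjugation, so the [l]-th
    Fourier coefficient of the t-Hermitian form at [Z] is the Hermitian form of
    the [l]-th slice at the [l]-th Fourier coefficients of [Z].  As the
    transform is invertible, these can be prescribed independently for each [l].

    For one conjugate partially symmetric [B], pairing the eigenvalue equations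
    with [z] gives [hform B z = lambda * \sum_i `|z_i| ^ (2k)].  Conversely, the
    quotient of [hform B] by that power sum is homogeneous of degree 0, so it
    attains its minimum [m] by compactness of a unit sphere.  Subtracting [m]
    times the diagonal tensor leaves a nonnegative form vanishing at the
    minimiser; its gradient vanishes there, which says that [m] is an
    eigenvalue.  Hence [B] is positive as soon as its eigenvalues are. *)
Require Import Defs.
From mathcomp Require Import all_boot all_order all_algebra all_fingroup.
From mathcomp Require Import complex.
From mathcomp Require Import reals trigo.
From mathcomp Require Import boolp classical_sets topology normedtype derive.
From mathcomp Require Import ring lra.
Set Implicit Arguments.
Unset Strict Implicit.
Unset Printing Implicit Defensive.
Import Order.TTheory GRing.Theory Num.Theory.
Import numFieldNormedType.Exports.
Local Open Scope ring_scope.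

(** * Fourier transform of tubes *)

Section FourierTransform.
Variables (R : realType) (p : nat).
Local Notation C := R[i].
Implicit Types a b : 'rV[C]_p.+1.

Lemma cexp_negD (x y : R) : cexp_neg (x + y) = cexp_neg x * cexp_neg y.
Proof. by rewrite /cexp_neg cosD sinD; simpc; congr Complex; ring. Qed.

Lemma cexp_negMn (x : R) m : cexp_neg (x *+ m) = cexp_neg x ^+ m.
Proof.
elim: m => [|m IH]; last by rewrite mulrS exprS cexp_negD IH.
by rewrite mulr0n expr0 /cexp_neg cos0 sin0 oppr0.
Qed.

Lemma cexp_negV (x : R) : Num.conj (cexp_neg x) * cexp_neg x = 1.
Proof.
rewrite /cexp_neg -[Num.conj _]/(Complex _ (- - _)); simpc.
rewrite mulrC -!expr2 cos2Dsin2; congr Complex; ring.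
Qed.

Lemma cexp_neg_neq0 (x : R) : cexp_neg x != 0.
Proof.
by apply/eqP => e0; have /eqP := cexp_negV x; rewrite e0 mulr0 eq_sym oner_eq0.
Qed.

(** Half-angle formula: [cos x = 1 - 2 sin(x/2)^2], and the sine is positive because [x / 2] lies
    strictly between 0 and [pi]. *)
Lemma cexp_neg_neq1 (x : R) : 0 < x < pi *+ 2 -> cexp_neg x != 1.
Proof.
move=> /andP[x0 x2]; apply/eqP => -[c1 _].
have s0 : 0 < sin (x / 2) by apply: sin_gt0_pi; apply/andP; split; lra.
have := cos_mulr2n (x / 2); rewrite cos2sin2.
rewrite (_ : x / 2 *+ 2 = x) ?c1; last by field.
move: (mulr_gt0 s0 s0); rewrite -expr2; lra.
Qed.

Definition fft_root : C := cexp_neg (2 * pi / p.+1%:R : R).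

Lemma fft_root_prim : p.+1.-primitive_root fft_root.
Proof.
apply/andP; split=> //; apply/forallP => i; rewrite unity_rootE -cexp_negMn.
rewrite -[_ *+ i.+1]mulr_natr.
have [->|ip] := eqVneq i.+1 p.+1.
  rewrite divfK ?pnatr_eq0// mulr_natl /cexp_neg cos2pi sin2pi.
  by rewrite oppr0 eqxx.
have {}ip : (i.+1 < p.+1)%N by rewrite ltn_neqAle ip ltn_ord.
rewrite eqbF_neg; apply: cexp_neg_neq1.
have pi2 : 0 < 2 * pi :> R by rewrite mulr_gt0 ?ltr0n ?pi_gt0.
rewrite !mulr_gt0 ?invr_gt0 ?ltr0n ?pi_gt0//= -[pi *+ 2]mulr_natl.
rewrite -mulrA gtr_pMr//.
by rewrite mulrC ltr_pdivrMr ?ltr0n// mul1r ltr_nat.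
Qed.

(** The transform acts on row vectors from the right, so [Z *m fft_mx] transforms all tubes of [Z]
    at once. *)
Definition fft_mx : 'M[C]_p.+1 := \matrix_(m, l) fft_root ^+ (m * l).

Lemma fftE a : fft a = a *m fft_mx.
Proof.
apply/rowP => l; rewrite !mxE; apply: eq_bigr => m _; rewrite mxE mulrC.
congr (_ * _); rewrite -cexp_negMn; congr cexp_neg.
rewrite mulnC -[RHS]mulr_natr natrM mulrAC -!mulrA.
by congr (_ * (_ * _)); rewrite mulrCA.
Qed.

(** The matrix of inverse powers is the inverse up to the factor [p.+1]: off the diagonal, the
    product is a geometric sum whose ratio [x != 1] satisfies [x ^+ p.+1 = 1]. *)
Lemma fft_mx_unit : fft_mx \in unitmx.
Proof.
have w_prim := fft_root_prim; have w0 : fft_root != 0 := cexp_neg_neq0 _.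
suff FF' : fft_mx *m (\matrix_(l, m) fft_root ^- (m * l)) = p.+1%:R%:M.
  have: fft_mx *m (p.+1%:R^-1 *: \matrix_(l, m) fft_root ^- (m * l)) = 1%:M.
    rewrite -scalemxAr FF' -scalemx1 scalerA mulVf ?scale1r//.
    by rewrite pnatr_eq0.
  by case/mulmx1_unit.
apply/matrixP => m m'; rewrite !mxE.
under eq_bigr => l _ do rewrite !mxE !exprM -exprVn -exprMn.
set x := _ / _.
have [mm|mm] := eqVneq m m'.
  have -> : x = 1 by rewrite /x mm divff// expf_neq0.
  by under eq_bigr do rewrite expr1n; rewrite sumr_const card_ord.
have /eqP : x ^+ p.+1 - 1 = 0.
  rewrite /x exprMn exprVn -!exprM ![(_ * p.+1)%N]mulnC !exprM.
  by rewrite (prim_expr_order w_prim) !expr1n divr1 subrr.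
rewrite subrX1 mulf_eq0 subr_eq0 => /orP[|/eqP ->]; last by rewrite mulr0n.
rewrite /x -(inj_eq (mulIf (expf_neq0 m' w0))) divfK ?expf_neq0// mul1r.
by rewrite (eq_prim_root_expr w_prim) !modn_small// => /(negP mm).
Qed.

(** Powers of the root depend only on the exponent modulo [p.+1], so the cyclic shift [s + m] splits
    the exponential into a product. *)
Lemma fft_tconv a b l : fft (tconv a b) 0 l = fft a 0 l * fft b 0 l.
Proof.
have w_prim := fft_root_prim.
rewrite !fftE !mxE mulr_suml.
under eq_bigr => m _ do rewrite !mxE mulr_suml.
rewrite exchange_big; apply: eq_bigr => m _ /=.
rewrite mulr_sumr (reindex (fun s : 'I_p.+1 => s + m)) /=; last first.
  by exists (fun s => s - m) => s _; rewrite ?addrK ?subrK.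
apply: eq_bigr => s _; rewrite !mxE addrK mulrACA; congr (_ * _).
rewrite -(prim_expr_mod w_prim) modnMml (prim_expr_mod w_prim).
by rewrite mulnDl exprD mulrC.
Qed.

Lemma fft_tconj a l : fft (tconj a) 0 l = Num.conj (fft a 0 l).
Proof.
have w_prim := fft_root_prim.
rewrite !fftE !mxE rmorph_sum /= (reindex_inj (@oppr_inj _)).
apply: eq_bigr => m _; rewrite !mxE opprK rmorphM rmorphXn /=; congr (_ * _).
have wm0 : fft_root ^+ (m * l) != 0 by rewrite expf_neq0 ?cexp_neg_neq0.
apply: (mulIf wm0).
rewrite -[in RHS]exprMn cexp_negV expr1n -exprD -mulnDl.
rewrite -(prim_expr_mod w_prim) -modnMml.
have -> : ((- m + m)%N %% p.+1)%N = (- m + m : 'I_p.+1) by [].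
by rewrite addNr mul0n mod0n expr0.
Qed.

Lemma fft_thform n k (A : thypermatrix R n k p.+1) (Z : 'M[C]_(n, p.+1)) l :
  fft (thform A Z) 0 l = hform (hat_slice A l) (col l (Z *m fft_mx)).
Proof.
rewrite fftE mulmx_suml summxE; apply: eq_bigr => i _.
rewrite mulmx_suml summxE; apply: eq_bigr => j _.
rewrite -fftE.
(* The convolutions are nested to the left, hence the induction from the end of the list. *)
have fold s : fft (foldl (@tconv R p) (A i j) s) 0 l =
    fft (A i j) 0 l * \prod_(a <- s) fft a 0 l.
  elim/last_ind: s => [|s a IH]; first by rewrite big_nil mulr1.
  by rewrite -cats1 foldl_cat /= fft_tconv IH big_cat big_seq1 mulrA.
rewrite fold big_cat mulrA !big_map; congr (_ * _ * _); apply: eq_bigr => a _.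
  by rewrite fft_tconj fftE -row_mul !mxE.
by rewrite fftE -row_mul !mxE.
Qed.

End FourierTransform.

(** * Hermitian forms and eigenvalues *)

Lemma big_tuple_cons (V : nmodType) (T : finType) k (F : k.+1.-tuple T -> V) :
  \sum_t F t = \sum_x \sum_(u : k.-tuple T) F (cons_tuple x u).
Proof.
rewrite pair_big /= (reindex (fun q : T * k.-tuple T => cons_tuple q.1 q.2)) //.
exists (fun t => (thead t, [tuple of behead t])) => [[x u] _ | t _] /=.
  by rewrite theadE; congr pair; apply: val_inj.
by rewrite [RHS]tuple_eta; apply: val_inj.
Qed.

Lemma deriv_prod (S : comNzRingType) (I : finType) (f : I -> {poly S}) :
  (\prod_i f i)^`() = \sum_i (f i)^`() * \prod_(j | j != i) f j.
Proof.
(* The induction needs a duplicate-free list: only then does [j != i] remove exactly one factor. *)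
have: uniq (index_enum I) by exact: index_enum_uniq.
elim: (index_enum I) => [|x r IH] /=; first by rewrite !big_nil derivC.
move=> /andP[xr /IH {}IH]; rewrite !big_cons derivM IH eqxx /=.
congr (_ * _ + _).
  by rewrite [RHS]big_seq_cond big_seq; apply: eq_bigl => j /=;
     case: eqVneq => [->|]; rewrite ?andbT// (negPf xr).
rewrite mulr_sumr big_seq [RHS]big_seq; apply: eq_bigr => j jr.
have xj : x != j by apply: contraNneq xr => ->.
by rewrite big_cons xj mulrCA.
Qed.

Lemma poly_bounded_disk (C : numFieldType) (q : {poly C}) :
  exists2 M, 0 <= M & forall t, `|t| <= 1 -> `|q.[t]| <= M.
Proof.
elim/poly_ind: q => [|q c [M M0 qM]].
  by exists 0 => // t _; rewrite horner0 normr0.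
exists (M + `|c|); first exact: addr_ge0.
move=> t t1; rewrite !hornerE (le_trans (ler_normD _ _))// lerD2r normrM.
by rewrite -[leRHS]mulr1 ler_pM// qM.
Qed.

(** With the constant term zero, [q = (r X + d) X], so [d + t r(t)] is nonnegative for [t > 0]; a
    negative [d] would dominate for small [t]. The order is partial, hence the negated
    conclusion. *)
Lemma deriv0_not_lt0 (C : numFieldType) (q : {poly C}) :
  (forall t, 0 <= t -> 0 <= q.[t]) -> q.[0] = 0 -> ~~ (q^`().[0] < 0).
Proof.
elim/poly_ind: q => [|q c _]; first by rewrite deriv0 horner0 ltxx.
elim/poly_ind: q => [|q d _].
  by rewrite mul0r add0r derivC horner0 ltxx.
rewrite !poly.derivE !hornerE /= => pos c0; rewrite c0 in pos.
apply/negP => d0; have [M M0 qM] := poly_bounded_disk q.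
have e0 : 0 < - d by rewrite oppr_gt0.
have s0 : 0 < M + - d + 1 by rewrite ltr_pwDr// addr_ge0// ltW.
(* This [t] is at most 1, so the bound [M] applies, and [t * M < - d], which contradicts
   nonnegativity. *)
pose t := - d / (M + - d + 1); have t0 : 0 < t by rewrite divr_gt0.
have t1 : `|t| <= 1.
  by rewrite gtr0_norm// ler_pdivrMr// mul1r addrAC lerDr addr_ge0.
have tE : t * (M + - d + 1) = - d by rewrite divfK// gt_eqF.
clearbody t; have := pos t (ltW t0).
rewrite !hornerE /= pmulr_lge0// -lerBlDr sub0r.
move=> h; have := real_ler_norm (ger0_real (le_trans (ltW e0) h)).
move=> /(le_trans h); rewrite normrM.
move=> /le_trans /(_ (ler_wpM2r (normr_ge0 t) (qM t t1))).
rewrite gtr0_norm// -tE [M * t]mulrC ler_pM2l// -addrA gerDl.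
by move=> /(lt_le_trans (ltr_pwDr ltr01 (ltW e0))); rewrite ltxx.
Qed.

Section HermitianForms.
Variables (R : realType) (n k : nat).
Local Notation C := R[i].
Local Notation K := k.+1.
Implicit Types (B : hypermatrix R n K) (z w : 'cV[C]_n).

(* Up to the factor [k.+1], the conjugate Wirtinger gradient of [hform B]. *)
Definition hgrad B z (i : 'I_n) : C :=
  \sum_(u : k.-tuple 'I_n) \sum_(j : K.-tuple 'I_n)
    B (cons_tuple i u) j * (\prod_(a <- u) Num.conj (z a 0))
                         * (\prod_(b <- j) z b 0).

Definition powersum z : C := \sum_i `|z i 0| ^+ (2 * K).

Lemma hform_hgrad B z : hform B z = \sum_i Num.conj (z i 0) * hgrad B z i.
Proof.
rewrite /hform big_tuple_cons; apply: eq_bigr => i _.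
rewrite mulr_sumr; apply: eq_bigr => u _.
rewrite mulr_sumr; apply: eq_bigr => j _.
by rewrite big_cons; ring.
Qed.

Lemma hform0 B : hform B 0 = 0.
Proof. by rewrite hform_hgrad big1 // => i _; rewrite mxE rmorph0 mul0r. Qed.

Lemma powersum0 : powersum 0 = 0.
Proof. by apply: big1 => i _; rewrite mxE normr0 mulnS expr0n. Qed.

Lemma hform_eigen B z lambda :
  (forall i, hgrad B z i = lambda * `|z i 0| ^+ (2 * k) * z i 0) ->
  hform B z = lambda * powersum z.
Proof.
move=> eig; rewrite hform_hgrad mulr_sumr; apply: eq_bigr => i _.
by rewrite eig mulnS exprD normCK; ring.
Qed.

Lemma powersum_gt0 z : z != 0 -> 0 < powersum z.
Proof.
move=> z0; have pos i : 0 <= `|z i 0| ^+ (2 * K) by rewrite exprn_ge0.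
rewrite lt_def sumr_ge0// andbT psumr_neq0//.
have [i zi|z00] := pickP (fun i => z i 0 != 0).
  by apply/hasP; exists i; rewrite ?mem_index_enum// exprn_gt0// normr_gt0.
case/eqP: z0; apply/colP => i; rewrite mxE; apply/eqP.
by have := z00 i; case: eqP.
Qed.

Lemma perm_tuple1 (T : nat) (i : T.-tuple 'I_n) : perm_tuple i 1 = i.
Proof. by apply: eq_from_tnth => a; rewrite tnth_mktuple perm1. Qed.

Lemma hform_real B z : conj_partially_symmetric B -> hform B z \is Num.real.
Proof.
move=> symB; rewrite CrealE /hform rmorph_sum /=; apply/eqP.
under eq_bigr do rewrite rmorph_sum.
rewrite exchange_big; apply: eq_bigr => i _; apply: eq_bigr => j _ /=.
rewrite !rmorphM /= -[RHS]mulrAC !rmorph_prod.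
rewrite -[in RHS](symB i j 1%g 1%g) !perm_tuple1.
by congr (_ * _ * _); apply: eq_bigr => a _ /=; rewrite ?conjCK.
Qed.

(* By symmetry of [c], all [K] terms of the product rule have the same sum. *)
Lemma sum_sym_deriv (S : comNzRingType) (c : K.-tuple 'I_n -> S)
    (x u : 'I_n -> S) :
  (forall i s, c (perm_tuple i s) = c i) ->
  \sum_i c i * (\sum_(a < K) u (tnth i a) *
                   \prod_(b < K | b != a) x (tnth i b)) =
  (\sum_y u y * \sum_(v : k.-tuple 'I_n)
                   c (cons_tuple y v) * \prod_(b <- v) x b) *+ K.
Proof.
move=> symc; under eq_bigr do rewrite mulr_sumr.
rewrite exchange_big /= -[in RHS](card_ord K) -sumr_const.
apply: eq_bigr => a _.
(* Exchanging positions 0 and [a] brings the differentiated factor to the head of the tuple. *)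
pose s := tperm ord0 a; have sK : involutive s by apply: tpermK.
rewrite (reindex_inj (h := fun i => perm_tuple i s)); last first.
  move=> i j /(congr1 (fun i => perm_tuple i s)) eq_ij.
  apply: eq_from_tnth => b; move/(congr1 (fun t => tnth t b)): eq_ij.
  by rewrite !tnth_mktuple !sK.
rewrite big_tuple_cons; apply: eq_bigr => y _; rewrite mulr_sumr.
apply: eq_bigr => v _; rewrite symc tnth_mktuple tpermR tnth0.
rewrite mulrCA; congr (_ * (_ * _)).
rewrite (reindex_inj (h := s)); last exact: perm_inj.
rewrite (eq_bigl (fun b => b != ord0)); last first.
  by move=> b; rewrite -(inj_eq (@perm_inj _ s)) sK tpermR.
under eq_bigr do rewrite tnth_mktuple sK.
rewrite big_mkcond big_ord_recl eqxx /= mul1r [RHS]big_tuple.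
by apply: eq_bigr => b _; rewrite tnthS.
Qed.

(** * First variation of a Hermitian form along a line *)

Definition line_poly (x u : 'I_n -> C) (i : K.-tuple 'I_n) : {poly C} :=
  \prod_(a <- i) ((x a)%:P + u a *: 'X).

Lemma horner_line_poly x u i t :
  (line_poly x u i).[t] = \prod_(a <- i) (x a + u a * t).
Proof. by rewrite horner_prod; apply: eq_bigr => a _; rewrite !hornerE. Qed.

Lemma deriv_line_poly x u i :
  (line_poly x u i)^`().[0] =
  \sum_(a < K) u (tnth i a) * \prod_(b < K | b != a) x (tnth i b).
Proof.
rewrite /line_poly big_tuple deriv_prod horner_sum; apply: eq_bigr => a _.
rewrite !poly.derivE !hornerE horner_prod /=.
by congr (_ * _); apply: eq_bigr => b _; rewrite !hornerE.
Qed.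

(** The indeterminate is treated as its own conjugate, so this polynomial represents
    [hform B (z + t *: w)] for real [t]. *)
Definition hform_line B z w : {poly C} :=
  \sum_(i : K.-tuple 'I_n) \sum_(j : K.-tuple 'I_n)
    B i j *:
      (line_poly (fun a => Num.conj (z a 0)) (fun a => Num.conj (w a 0)) i *
       line_poly (fun a => z a 0) (fun a => w a 0) j).

Lemma horner_hform_line B z w t : t \is Num.real ->
  (hform_line B z w).[t] = hform B (z + t *: w).
Proof.
move=> /CrealP tR; rewrite horner_sum; apply: eq_bigr => i _.
rewrite horner_sum; apply: eq_bigr => j _.
rewrite hornerZ hornerM !horner_line_poly mulrA; congr (_ * _ * _).
  by apply: eq_bigr => a _; rewrite !mxE rmorphD rmorphM /= tR mulrC.
by apply: eq_bigr => a _; rewrite !mxE mulrC.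
Qed.

Lemma cps_perm B i j s : conj_partially_symmetric B ->
  B (perm_tuple i s) j = B i j.
Proof.
move=> symB; rewrite -(symB i j 1%g s) -(symB (perm_tuple i s) j 1%g 1%g).
by rewrite !perm_tuple1.
Qed.

(** By the product rule, differentiating the conjugated factors gives [D]; the remaining terms give
    its conjugate, by the symmetry exchanging [i] and [j]. *)
Lemma deriv_hform_line B z w : conj_partially_symmetric B ->
  let d := (\sum_i Num.conj (w i 0) * hgrad B z i) *+ K in
  (hform_line B z w)^`().[0] = d + Num.conj d.
Proof.
move=> symB d.
pose zp (j : K.-tuple 'I_n) := \prod_(b <- j) z b 0.
pose dzp (j : K.-tuple 'I_n) :=
  \sum_(a < K) w (tnth j a) 0 * \prod_(b < K | b != a) z (tnth j b) 0.
pose D := \sum_(i : K.-tuple 'I_n) \sum_(j : K.-tuple 'I_n)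
  B i j * (Num.conj (dzp i) * zp j).
have line0 x u i : (line_poly x u i).[0] = \prod_(a <- i) x a.
  by rewrite horner_line_poly; apply: eq_bigr => a _; rewrite mulr0 addr0.
have dconj i : \sum_(a < K) Num.conj (w (tnth i a) 0) *
    \prod_(b < K | b != a) Num.conj (z (tnth i b) 0) = Num.conj (dzp i).
  rewrite rmorph_sum; apply: eq_bigr => a _.
  by rewrite rmorphM rmorph_prod.
have -> : (hform_line B z w)^`().[0] = D + Num.conj D.
  have -> : Num.conj D = \sum_(i : K.-tuple 'I_n) \sum_(j : K.-tuple 'I_n)
      B i j * (Num.conj (zp i) * dzp j).
    rewrite rmorph_sum /=; under eq_bigr do rewrite rmorph_sum.
    rewrite exchange_big; apply: eq_bigr => i _; apply: eq_bigr => j _ /=.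
    rewrite !rmorphM /= conjCK [dzp _ * _]mulrC.
    by rewrite -[in RHS](symB i j 1%g 1%g) !perm_tuple1.
  rewrite -big_split raddf_sum horner_sum; apply: eq_bigr => i _ /=.
  rewrite -big_split raddf_sum horner_sum; apply: eq_bigr => j _ /=.
  rewrite !poly.derivE !hornerE !line0 !deriv_line_poly dconj /= -!mulrA -mulrDr.
  by rewrite /zp rmorph_prod.
suff -> : D = d by [].
rewrite /D; under eq_bigr => i _.
  under eq_bigr do rewrite mulrCA.
  rewrite -mulr_sumr mulrC -dconj.
  over.
(* Summing over [j] first leaves coefficients symmetric in [i], so the [K] positions contribute
   equally. *)
rewrite (sum_sym_deriv (c := fun i => \sum_j B i j * zp j)
  (fun y => Num.conj (z y 0)) (fun y => Num.conj (w y 0))); last first.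
  by move=> i s; apply: eq_bigr => j _; rewrite cps_perm.
congr (_ *+ K); apply: eq_bigr => i _; congr (_ * _).
apply: eq_bigr => v _; rewrite mulr_suml; apply: eq_bigr => j _.
by rewrite mulrAC.
Qed.

(** A zero of a nonnegative form is a minimum, hence a critical point. *)
Lemma hgrad_eq0 B z : conj_partially_symmetric B ->
  (forall w, 0 <= hform B w) -> hform B z = 0 -> forall i, hgrad B z i = 0.
Proof.
move=> symB pos hz.
(* Otherwise the form would decrease to first order along [z + t w]. *)
pose w : 'cV_n := \col_i (- hgrad B z i).
have real0 (t : C) : 0 <= t -> t \is Num.real by move/ger0_real.
have := @deriv0_not_lt0 _ (hform_line B z w).
rewrite horner_hform_line ?real0// scale0r addr0 => /(_ _ hz).
have lpos t : 0 <= t -> 0 <= (hform_line B z w).[t].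
  by move=> t0; rewrite horner_hform_line ?real0.
move=> /(_ lpos); rewrite deriv_hform_line //=.
set s := \sum_i _.
have sE : s = - \sum_i `|hgrad B z i| ^+ 2.
  rewrite -sumrN; apply: eq_bigr => i _.
  by rewrite mxE rmorphN mulNr mulrC -normCK.
have ge0 i : 0 <= `|hgrad B z i| ^+ 2 by rewrite exprn_ge0.
have s0 : 0 <= \sum_i `|hgrad B z i| ^+ 2 by apply: sumr_ge0.
(* As [s] is real, the derivative is [2 * K * s], a negative multiple of the squared norm of the
   gradient. *)
have /CrealP -> : s *+ K \is Num.real by rewrite rpredMn// sE rpredN ger0_real.
rewrite -mulr2n -mulrnA sE mulNrn oppr_lt0 pmulrn_lgt0//.
rewrite lt_def s0 andbT negbK psumr_eq0// => /allP all0 i.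
have /implyP/(_ isT) := all0 i (mem_index_enum i).
by rewrite expf_eq0 /= normr_eq0 => /eqP.
Qed.

(* The tensor whose form is [powersum]. *)
Definition diag_tensor : hypermatrix R n K := fun i j =>
  \sum_x ((i == nseq_tuple K x) && (j == nseq_tuple K x))%:R.

Lemma perm_tuple_nseq (i : K.-tuple 'I_n) s x :
  (perm_tuple i s == nseq_tuple K x) = (i == nseq_tuple K x).
Proof.
have constP (t : K.-tuple 'I_n) :
    (t == nseq_tuple K x) = [forall a, tnth t a == x].
  apply/eqP/forallP => [-> a|tx]; first by rewrite tnth_nseq.
  by apply: eq_from_tnth => a; rewrite tnth_nseq; apply/eqP.
rewrite !constP; apply/forallP/forallP => h a.
  by have := h (s^-1%g a); rewrite tnth_mktuple permKV.
by rewrite tnth_mktuple.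
Qed.

Lemma diag_tensor_cps : conj_partially_symmetric diag_tensor.
Proof.
move=> i j s t; rewrite rmorph_sum; apply: eq_bigr => x _.
by rewrite rmorph_nat !perm_tuple_nseq andbC.
Qed.

Lemma diag_tensor_cons i (u : k.-tuple 'I_n) j :
  diag_tensor (cons_tuple i u) j =
  (u == nseq_tuple k i)%:R * (j == nseq_tuple K i)%:R.
Proof.
rewrite -natrM mulnb /diag_tensor (bigD1 i) //= big1 ?addr0 => [|x xi].
  by congr (_ && _)%:R; rewrite -!(inj_eq val_inj) /= eqseq_cons eqxx.
by rewrite -(inj_eq val_inj) /= eqseq_cons eq_sym (negPf xi).
Qed.

Lemma hgrad_diag z i : hgrad diag_tensor z i = `|z i 0| ^+ (2 * k) * z i 0.
Proof.
have prod_nseq m (f : 'I_n -> C) : \prod_(a <- nseq m i) f a = f i ^+ m.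
  by rewrite big_nseq iter_mulr_1.
rewrite /hgrad (bigD1 (nseq_tuple k i)) //= [X in _ + X]big1; last first.
  move=> u ui; apply: big1 => j _.
  by rewrite diag_tensor_cons (negPf ui) !mul0r.
rewrite addr0 (bigD1 (nseq_tuple K i)) //= [X in _ + X]big1; last first.
  by move=> j ji; rewrite diag_tensor_cons (negPf ji) mulr0 !mul0r.
rewrite addr0 diag_tensor_cons !eqxx !mul1r -[i :: _]/(nseq K i) !prod_nseq.
by rewrite exprSr mulrA -exprMn [X in X ^+ k]mulrC -normCK -exprM.
Qed.

Lemma hgrad_shift B m z i :
  hgrad (fun i j => B i j - m * diag_tensor i j) z i =
  hgrad B z i - m * (`|z i 0| ^+ (2 * k) * z i 0).
Proof.
rewrite -hgrad_diag mulr_sumr -sumrB; apply: eq_bigr => u _.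
rewrite mulr_sumr -sumrB; apply: eq_bigr => j _.
ring.
Qed.

Lemma hform_shift B m z :
  hform (fun i j => B i j - m * diag_tensor i j) z =
  hform B z - m * powersum z.
Proof.
rewrite !hform_hgrad mulr_sumr -sumrB; apply: eq_bigr => i _.
by rewrite hgrad_shift mulnS exprD normCK; ring.
Qed.

(** Since [m] is real, subtracting [m * diag_tensor] preserves conjugate partial symmetry, and
    [hgrad_eq0] applies to the difference at [z]. *)
Lemma critical_eigenvalue B m z : conj_partially_symmetric B ->
  m \is Num.real -> z != 0 -> (forall w, m * powersum w <= hform B w) ->
  hform B z = m * powersum z -> Hhat_eigenvalue B m.
Proof.
move=> symB /CrealP mR z0 min_m min_z; exists z => // i.
apply/eqP; rewrite -mulrA -subr_eq0 -[X in X - _]/(hgrad B z i) -hgrad_shift.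
apply/eqP/hgrad_eq0 => [j1 j2 s t|w|].
- by rewrite rmorphB rmorphM /= mR symB diag_tensor_cps.
- by rewrite hform_shift subr_ge0.
- by rewrite hform_shift min_z subrr.
Qed.

End HermitianForms.

(** * The smallest eigenvalue *)

Section MinimalEigenvalue.
Variables (R : realType) (n k : nat).
Local Notation C := R[i].
Local Notation K := k.+1.
Implicit Types (B : hypermatrix R n.+1 K) (z : 'cV[C]_n.+1).

(** Real coordinates make compactness and the extreme value theorem for real functions available. *)
Definition vec_of_real (x : 'rV[R]_(n.+1 + n.+1)) : 'cV[C]_n.+1 :=
  \col_i Complex (x 0 (lshift n.+1 i)) (x 0 (rshift n.+1 i)).

(** Continuity is stated through real and imaginary parts, so that only the topology of [R] is
    involved on the target. *)
Definition parts_continuous (T : topologicalType) (f : T -> C) : Prop :=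
  continuous (fun x => complex.Re (f x)) /\
  continuous (fun x => complex.Im (f x)).

Lemma parts_continuous_cst (T : topologicalType) (c : C) :
  parts_continuous (fun _ : T => c).
Proof. by split=> x; apply: cvg_cst. Qed.

Lemma parts_continuousD (T : topologicalType) (f g : T -> C) :
  parts_continuous f -> parts_continuous g ->
  parts_continuous (fun x => f x + g x).
Proof.
move=> [f1 f2] [g1 g2]; split=> x.
  rewrite (_ : (fun x => _) = (fun x => complex.Re (f x) + complex.Re (g x))).
    exact: (continuousD (f1 x) (g1 x)).
  by apply/funext => y; case: (f y) (g y) => [a b] [c d].
rewrite (_ : (fun x => _) = (fun x => complex.Im (f x) + complex.Im (g x))).
  exact: (continuousD (f2 x) (g2 x)).
by apply/funext => y; case: (f y) (g y) => [a b] [c d].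
Qed.

Lemma parts_continuousM (T : topologicalType) (f g : T -> C) :
  parts_continuous f -> parts_continuous g ->
  parts_continuous (fun x => f x * g x).
Proof.
move=> [f1 f2] [g1 g2]; split=> x.
  rewrite (_ : (fun x => _) = (fun x => complex.Re (f x) * complex.Re (g x) -
      complex.Im (f x) * complex.Im (g x))).
    exact: (continuousB (continuousM (f1 x) (g1 x))
                        (continuousM (f2 x) (g2 x))).
  by apply/funext => y; case: (f y) (g y) => [a b] [c d].
rewrite (_ : (fun x => _) = (fun x => complex.Re (f x) * complex.Im (g x) +
    complex.Im (f x) * complex.Re (g x))).
  exact: (continuousD (continuousM (f1 x) (g2 x)) (continuousM (f2 x) (g1 x))).
by apply/funext => y; case: (f y) (g y) => [a b] [c d].
Qed.

Lemma parts_continuous_conj (T : topologicalType) (f : T -> C) :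
  parts_continuous f -> parts_continuous (fun x => Num.conj (f x)).
Proof.
move=> [f1 f2]; split=> x.
  rewrite (_ : (fun x => _) = (fun x => complex.Re (f x))); first exact: f1.
  by apply/funext => y; case: (f y).
rewrite (_ : (fun x => _) = (fun x => - complex.Im (f x))).
  exact: (continuousN (f2 x)).
by apply/funext => y; case: (f y).
Qed.

Lemma parts_continuous_sum (T : topologicalType) (I : Type) (r : seq I)
    (f : I -> T -> C) :
  (forall i, parts_continuous (f i)) ->
  parts_continuous (fun x => \sum_(i <- r) f i x).
Proof.
move=> fc; elim: r => [|i r IH].
  under [X in parts_continuous X]funext do rewrite big_nil.
  exact: parts_continuous_cst.
under [X in parts_continuous X]funext do rewrite big_cons.
exact: parts_continuousD.
Qed.

Lemma parts_continuous_prod (T : topologicalType) (I : Type) (r : seq I)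
    (f : I -> T -> C) :
  (forall i, parts_continuous (f i)) ->
  parts_continuous (fun x => \prod_(i <- r) f i x).
Proof.
move=> fc; elim: r => [|i r IH].
  under [X in parts_continuous X]funext do rewrite big_nil.
  exact: parts_continuous_cst.
under [X in parts_continuous X]funext do rewrite big_cons.
exact: parts_continuousM.
Qed.

Lemma vec_of_real_continuous i :
  parts_continuous (fun x => vec_of_real x i 0).
Proof.
by split=> x; under [X in continuous_at x X]funext do rewrite mxE /=;
   exact: coord_continuous.
Qed.

Lemma hform_continuous B : parts_continuous (fun x => hform B (vec_of_real x)).
Proof.
apply: parts_continuous_sum => i; apply: parts_continuous_sum => j.
have zc := vec_of_real_continuous.
apply: parts_continuousM; last exact: parts_continuous_prod.
apply: parts_continuousM; first exact: parts_continuous_cst.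
by apply: parts_continuous_prod => a; apply: parts_continuous_conj.
Qed.

Lemma powersum_continuous :
  parts_continuous (fun x => powersum k (vec_of_real x)).
Proof.
have zc := vec_of_real_continuous.
apply: parts_continuous_sum => i.
(* Writing the even power of the modulus as [K] factors [z * conj z] reduces the claim to products
   and conjugates. *)
under [X in parts_continuous X]funext => x.
  rewrite exprM normCK -[K in _ ^+ K]card_ord -prodr_const.
  over.
apply: parts_continuous_prod => _; apply: parts_continuousM; first exact: zc.
by apply: parts_continuous_conj; exact: zc.
Qed.

Lemma vec_of_realZ (r : R) x : vec_of_real (r *: x) = r%:C%C *: vec_of_real x.
Proof. by apply/colP => i; rewrite !mxE; simpc. Qed.

Lemma vec_of_real_surj z : exists x, vec_of_real x = z.
Proof.
exists (row_mx (\row_i complex.Re (z i 0)) (\row_i complex.Im (z i 0))).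
by apply/colP => i; rewrite mxE row_mxEl row_mxEr !mxE; case: (z i 0).
Qed.

Lemma vec_of_real_eq0 x : vec_of_real x = 0 -> x = 0.
Proof.
move=> x0; rewrite -[x]hsubmxK -[RHS]row_mx0.
by congr row_mx; apply/rowP => i; have /colP/(_ i) := x0; rewrite !mxE => -[].
Qed.

Lemma hformZ B (r : R) z :
  hform B (r%:C%C *: z) = r%:C%C ^+ (2 * K) * hform B z.
Proof.
rewrite mulr_sumr; apply: eq_bigr => i _; rewrite mulr_sumr.
apply: eq_bigr => j _.
have prodZ (t : K.-tuple 'I_n.+1) (f : 'I_n.+1 -> C) :
    \prod_(a <- t) (r%:C%C * f a) = r%:C%C ^+ K * \prod_(a <- t) f a.
  by rewrite !big_tuple big_split prodr_const card_ord.
have rR : Num.conj (r%:C%C : C) = r%:C%C.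
  by rewrite -[LHS]/(Complex _ _) oppr0.
under eq_bigr do rewrite mxE rmorphM /= rR.
under [X in _ * X]eq_bigr do rewrite mxE.
rewrite !prodZ mul2n -addnn exprD; ring.
Qed.

Lemma powersumZ (r : R) z :
  powersum k (r%:C%C *: z) = r%:C%C ^+ (2 * K) * powersum k z.
Proof.
rewrite mulr_sumr; apply: eq_bigr => i _; rewrite mxE normrM exprMn.
congr (_ * _); rewrite !exprM normCK.
by rewrite -[Num.conj _]/(Complex _ _) oppr0.
Qed.

Lemma min_eigenvalue B : conj_partially_symmetric B ->
  exists2 m, Hhat_eigenvalue B m & forall z, m * powersum k z <= hform B z.
Proof.
move=> symB.
(* This is the unit sphere of the sup norm on real coordinates; homogeneity of degree 0 makes the
   choice of norm immaterial. *)
pose S := [set x : 'rV[R]_(n.+1 + n.+1) | `|x| = 1]%classic.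
pose h x := complex.Re (hform B (vec_of_real x)).
pose N x := complex.Re (powersum k (vec_of_real x)).
have hE x : hform B (vec_of_real x) = (h x)%:C%C.
  by rewrite RRe_real// hform_real.
have powersum_real z : powersum k z \is Num.real.
  by apply: ger0_real; apply: sumr_ge0 => i _; rewrite exprn_ge0.
have NE x : powersum k (vec_of_real x) = (N x)%:C%C by rewrite RRe_real.
have N0 x : x != 0 -> 0 < N x.
  move=> x0; have : vec_of_real x != 0.
    by apply: contraNneq x0 => /vec_of_real_eq0 ->.
  by move/(powersum_gt0 k); rewrite ltcE => /andP[].
have S0 x : S x -> x != 0.
  by move=> Sx; rewrite -normr_eq0 Sx oner_eq0.
have cS : compact S.
  apply: bounded_closed_compact.
    by exists 1; split => // M M1 x /= ->; apply: ltW.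
  have /continuous_closedP := @norm_continuous R 'rV[R]_(n.+1 + n.+1).
  by move=> /(_ _ (@closed_eq R 1)).
(* Normalising [x] multiplies numerator and denominator by the same factor [r ^+ (2 * K)]. *)
have homog x : x != 0 -> exists2 y, S y & h x / N x = h y / N y.
  move=> x0; pose r := `|x|^-1.
  have r0 : r != 0 by rewrite invr_neq0 ?normr_eq0.
  exists (r *: x).
    by rewrite /S /= normrZ /r normfV normr_id mulVf// normr_eq0.
  have -> : h (r *: x) = r ^+ (2 * K) * h x.
    by apply: (@complexI R);
       rewrite -hE vec_of_realZ hformZ hE -rmorphXn -rmorphM.
  have -> : N (r *: x) = r ^+ (2 * K) * N x.
    by apply: (@complexI R);
       rewrite -NE vec_of_realZ powersumZ NE -rmorphXn -rmorphM.
  by rewrite -mulf_div divff ?mul1r// expf_neq0.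
have neS : (S !=set0)%classic.
  have e0 : const_mx 1 != 0 :> 'rV[R]_(n.+1 + n.+1).
    by apply/eqP => /rowP/(_ ord0); rewrite !mxE; apply/eqP/oner_neq0.
  by have [y Sy _] := homog _ e0; exists y.
have [|x0 /set_mem Sx0 min_x0] := EVT_min_rV (f := fun x => h x / N x) neS cS.
  (* Continuity is only claimed on [S], where the denominator is positive. *)
  apply: continuous_in_subspaceT => x /set_mem/S0/N0 Nx.
  apply: continuousM; first exact: (hform_continuous B).1.
  by apply: continuousV; [rewrite gt_eqF|apply: powersum_continuous.1].
have min_h x : x != 0 -> h x0 / N x0 * N x <= h x.
  move=> xn0; rewrite -ler_pdivlMr ?N0//.
  by have [y Sy ->] := homog x xn0; apply: min_x0; rewrite inE.
have minB z : (h x0 / N x0)%:C%C * powersum k z <= hform B z.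
  have [->|z0] := eqVneq z 0; first by rewrite hform0 powersum0 mulr0.
  have [x xz] := vec_of_real_surj z; rewrite -xz NE hE -rmorphM lecR.
  apply: min_h; apply: contraNneq z0 => x_eq0; rewrite -xz x_eq0.
  by apply/eqP/colP => i; rewrite !mxE.
exists (h x0 / N x0)%:C%C => //.
apply: (@critical_eigenvalue _ _ _ _ _ (vec_of_real x0)) => //.
- by rewrite complex_real.
- by apply: contraNneq (S0 _ Sx0) => /vec_of_real_eq0 ->.
- by rewrite hE NE -rmorphM divfK// gt_eqF// N0// S0.
Qed.

End MinimalEigenvalue.

(** * Positivity of a single hypermatrix through its eigenvalues *)

Lemma hermitian_pd_eigenvalue (R : realType) n k (B : hypermatrix R n.+1 k.+1) :
  conj_partially_symmetric B ->
  hermitian_pd B <-> forall lambda, Hhat_eigenvalue B lambda -> 0 < lambda.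
Proof.
move=> symB; split=> [pdB lambda [z z0 eig]|pos z z0].
  by have := pdB z z0; rewrite (hform_eigen eig) pmulr_lgt0// powersum_gt0.
have [m /pos m0 min_m] := min_eigenvalue symB.
by apply: lt_le_trans (min_m z); rewrite mulr_gt0// powersum_gt0.
Qed.

Lemma hermitian_psd_eigenvalue (R : realType) n k
    (B : hypermatrix R n.+1 k.+1) :
  conj_partially_symmetric B ->
  hermitian_psd B <-> forall lambda, Hhat_eigenvalue B lambda -> 0 <= lambda.
Proof.
move=> symB; split=> [psdB lambda [z z0 eig]|pos z z0].
  by have := psdB z z0; rewrite (hform_eigen eig) pmulr_lge0// powersum_gt0.
have [m /pos m0 min_m] := min_eigenvalue symB.
by apply: le_trans (min_m z); rewrite mulr_ge0// ltW// powersum_gt0.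
Qed.

(** * Reduction of t-positivity to the Fourier slices *)

Section FourierSlices.
Variables (R : realType) (n k p : nat) (A : thypermatrix R n k.+1 p.+1).
Local Notation C := R[i].

(** Inverse transform of the matrix with column [l] equal to [z] and all other columns zero: a test
    vector that isolates slice [l]. *)
Definition single_slice (l : 'I_p.+1) (z : 'cV[C]_n) : 'M[C]_(n, p.+1) :=
  z *m delta_mx 0 l *m invmx (fft_mx R p).

Lemma fft_single_slice l l' z :
  fft (thform A (single_slice l z)) 0 l' =
  if l' == l then hform (hat_slice A l) z else 0.
Proof.
rewrite fft_thform mulmxKV ?fft_mx_unit// colE -mulmxA.
have [->|ll] := eqVneq l' l.
  by rewrite mul_delta_mx [delta_mx 0 0]mx11_scalar mxE !eqxx mulmx1.
by rewrite mul_delta_mx_0 1?eq_sym// mulmx0 hform0.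
Qed.

Lemma single_slice_neq0 l z : z != 0 -> single_slice l z != 0.
Proof.
apply: contraNneq => Z0.
have := mulmxKV (fft_mx_unit R p) (z *m delta_mx 0 l).
rewrite -/(single_slice l z) Z0 mul0mx => /(congr1 (col l)).
rewrite colE mul0mx colE -mulmxA mul_delta_mx [delta_mx 0 0]mx11_scalar mxE.
by rewrite !eqxx mulmx1 => <-.
Qed.

Lemma t_hermitian_psdP :
  t_hermitian_psd A <-> forall l, hermitian_psd (hat_slice A l).
Proof.
split=> [psdA l z z0|psd Z _ l].
  have := psdA _ (single_slice_neq0 l z0) l.
  by rewrite fft_single_slice eqxx.
rewrite fft_thform; set z := col l _.
(* A Fourier column may vanish even if [Z] does not; the form is then 0. *)
by have [->|/psd] := eqVneq z 0; first by rewrite hform0.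
Qed.

Lemma t_hermitian_pdP :
  t_hermitian_pd A <-> forall l, hermitian_pd (hat_slice A l).
Proof.
split=> [pdA l z z0|pd Z Z0].
  have [pos] := pdA _ (single_slice_neq0 l z0).
  have := pos l; rewrite fft_single_slice eqxx lt_def => -> /eqP nz.
  (* All other Fourier coefficients of the tube already vanish, so if the [l]-th did too, the tube
     would be zero. *)
  rewrite andbT; apply/eqP => h0; apply: nz.
  apply: (can_inj (mulmxK (fft_mx_unit R p))); rewrite mul0mx -fftE.
  by apply/rowP => l'; rewrite fft_single_slice h0 if_same mxE.
split.
  by apply: t_hermitian_psdP.2 Z Z0 => l z z0; exact: ltW (pd l z z0).
(* Invertibility of the transform gives a nonzero Fourier column; the form of that slice is positive
   there, so the tube is nonzero. *)
have [l Zl] : exists l, col l (Z *m fft_mx R p) != 0.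
  apply/existsP; apply: contraNT Z0; rewrite negb_exists => /forallP Zl.
  apply/eqP/(can_inj (mulmxK (fft_mx_unit R p))); rewrite mul0mx.
  apply/matrixP => i l; have := Zl l; rewrite negbK => /eqP/colP/(_ i).
  by rewrite !mxE.
apply: contraTneq (pd l _ Zl) => h0.
by rewrite -fft_thform h0 fftE mul0mx mxE ltxx.
Qed.

End FourierSlices.

(* The paper's k, n, p >= 1 are k.+1, n.+1, p.+1. *)
Theorem theorem3p30 (R : realType) (k n p : nat)
    (A : thypermatrix R n.+1 k.+1 p.+1)
    (hA : t_conj_partially_symmetric A) :
  ((t_hermitian_pd A <-> (forall l : 'I_p.+1, hermitian_pd (hat_slice A l))) /\
   ((forall l : 'I_p.+1, hermitian_pd (hat_slice A l)) <->
    (forall (l : 'I_p.+1) (lambda : R[i]),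
        Hhat_eigenvalue (hat_slice A l) lambda -> 0 < lambda))) /\
  ((t_hermitian_psd A <-> (forall l : 'I_p.+1, hermitian_psd (hat_slice A l))) /\
   ((forall l : 'I_p.+1, hermitian_psd (hat_slice A l)) <->
    (forall (l : 'I_p.+1) (lambda : R[i]),
        Hhat_eigenvalue (hat_slice A l) lambda -> 0 <= lambda))).
Proof.
split; split; [exact: t_hermitian_pdP| |exact: t_hermitian_psdP|].
  split=> pos l; first exact: (hermitian_pd_eigenvalue (hA l)).1 (pos l).
  exact: (hermitian_pd_eigenvalue (hA l)).2 (pos l).
split=> pos l; first exact: (hermitian_psd_eigenvalue (hA l)).1 (pos l).
exact: (hermitian_psd_eigenvalue (hA l)).2 (pos l).
Qed.
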